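(* Let $p\ge 2$ and $\beta\in(\tfrac43,2)$. Then there is a constant $C>0$ such that for every $t\in[0,T]$, $x\in\mathbb{T}$ and $h>0$ with $t+h\le T$, $$\mathbf{E}\bigl|Y(t+h,x)-Y(t,x)\bigr|^{p}\le C\,h^{\frac{p}{\beta}} .$$
   Context: Fix $T>0$. $\mathbb{T}=\mathbb{R}/\mathbb{Z}$ is the one-dimensional flat torus, identified with $[0,1)$ with periodic boundary conditions. $p_t(x)=\sum_{k\in\mathbb{Z}}\frac{1}{\sqrt{4\pi t}}e^{-(x-k)^2/(4t)}$ is the periodic heat kernel. $W$ is a space-time Gaussian white noise on $[0,T]\times\mathbb{T}$, i.e. a centered Gaussian family with $\mathbf{E}[W(A)W(B)]=\lambda(A\cap B)$ for Borel $A,B\subset[0,T]\times\mathbb{T}$, $\lambda$ being Lebesgue measure. Let $f(u)=u-u^3$, and let $u$ be the unique mild solution, with zero initial condition, of the stochastic Allen--Cahn equation $\partial_t u=\partial_x^2u+f(u)+\dot W$ on $[0,T]\times\mathbb{T}$, i.e. $$u(t,x)=\int_0^t\!\int_{\mathbb{T}}p_{t-s}(x-y)f(u(s,y))\,dy\,ds+\int_0^t\!\int_{\mathbb{T}}p_{t-s}(x-y)\,W(ds,dy);$$ it satisfies $\sup_{t\in[0,T],x\in\mathbb{T}}\mathbf{E}|u(t,x)|^q<\infty$ for all $q\ge2$. Put $$Y(t,x)=\int_0^t\!\int_{\mathbb{T}}p_{t-s}(x-y)f(u(s,y))\,dy\,ds .$$ *)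

(* Defs.v *)
From HB Require Import structures.
From mathcomp Require Import all_boot all_order all_algebra.
From mathcomp Require Import all_classical all_reals all_analysis.

Set Implicit Arguments.
Unset Strict Implicit.
Unset Printing Implicit Defensive.

Import Order.TTheory GRing.Theory Num.Theory.
Import numFieldNormedType.Exports.

Local Open Scope classical_set_scope.
Local Open Scope ring_scope.

(* Two copies of R with the sigma-algebra on which lebesgue_measure is defined.
   It is the Borel one, under another display than the canonical instance of R;
   with the latter, the lemmas on product measures do not unify. *)
Notation plane R := (measurableTypeR R * measurableTypeR R)%type.

(* The torus R/Z is identified with `[0, 1[: functions of a torus variable are
   only ever evaluated there, and differences x - y are taken in R, which is
   harmless since they only enter through the 1-periodic heat kernel. *)
Definition spacetime (R : realType) (T : R) : set (plane R) :=
  `[0, T] `*` `[0, 1[.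

Definition leb2 (R : realType) : set (plane R) -> \bar R :=
  (@lebesgue_measure R \x @lebesgue_measure R)%E.

Definition heat_kernel (R : realType) (t x : R) : R :=
  fine (\esum_(k in [set: int])
    ((Num.sqrt (4 * pi * t))^-1 * expR (- (x - k%:~R) ^+ 2 / (4 * t)))%:E).

(* Degenerate laws are Gaussian; they are singled out because
   [normal_prob 0 0] is not the Dirac mass at 0. *)
Definition centered_gaussian (R : realType) (d : measure_display)
    (Om : measurableType d) (P : probability Om R) (X : Om -> R) : Prop :=
  measurable_fun [set: Om] X /\
  exists s : R, forall B : set R, measurable B ->
    P (X @^-1` B) = if s == 0 then \d_(0 : R) B else normal_prob 0 s B.

(* A finite list of pairs (c, A) encodes the step function \sum c \1_A. *)
Definition adm_steps (R : realType) (T : R)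
    (e : seq (R * set (plane R))) : Prop :=
  forall i : nat, (i < size e)%N ->
    measurable (nth (0, set0) e i).2 /\ (nth (0, set0) e i).2 `<=` spacetime T.

Definition step_fun (R : realType) (e : seq (R * set (plane R)))
    (z : plane R) : R :=
  \sum_(c <- e) c.1 * \1_(c.2) z.

Definition noise_step (R : realType) (Om : Type) (W : set (plane R) -> Om -> R)
    (e : seq (R * set (plane R))) (w : Om) : R :=
  \sum_(c <- e) c.1 * W c.2 w.

(* A family is centered Gaussian when all its finite linear combinations are
   centered Gaussian variables. *)
Definition white_noise (R : realType) (d : measure_display)
    (Om : measurableType d) (P : probability Om R) (T : R)
    (W : set (plane R) -> Om -> R) : Prop :=
  (forall e, adm_steps T e -> centered_gaussian P (noise_step W e)) /\
  (forall A B : set (plane R), measurable A -> A `<=` spacetime T ->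
    measurable B -> B `<=` spacetime T ->
    'E_P[(fun w => W A w * W B w)%R]%E = leb2 (A `&` B)).

(* Z is a version of \int phi dW: the L^2(P)-limit of the integrals of step
   functions converging to phi in L^2([0, T] x [0, 1[). *)
Definition wiener_integral (R : realType) (d : measure_display)
    (Om : measurableType d) (P : probability Om R) (T : R)
    (W : set (plane R) -> Om -> R) (phi : plane R -> R) (Z : Om -> R) : Prop :=
  measurable_fun [set: Om] Z /\
  exists e : nat -> seq (R * set (plane R)),
    [/\ forall n, adm_steps T (e n),
        (fun n => \int[@leb2 R]_(z in spacetime T)
                    ((step_fun (e n) z - phi z) ^+ 2)%:E)%E @ \oo --> 0%E
      & (fun n => 'E_P[(fun w => (noise_step W (e n) w - Z w) ^+ 2)%R])%E
          @ \oo --> 0%E].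

Definition allen_cahn (R : realType) (v : R) : R := v - v ^+ 3.

Definition drift (R : realType) (Om : Type) (u : R -> R -> Om -> R)
    (t x : R) (w : Om) : R :=
  \int[lebesgue_measure]_(s in `[0, t]) \int[lebesgue_measure]_(y in `[0, 1[)
    (heat_kernel (t - s) (x - y) * allen_cahn (u s y w)).

(* The almost sure integrability says that the drift integral makes sense. *)
Definition mild_solution (R : realType) (d : measure_display)
    (Om : measurableType d) (P : probability Om R) (T : R)
    (W : set (plane R) -> Om -> R) (u : R -> R -> Om -> R) : Prop :=
  measurable_fun (spacetime T `*` [set: Om])
    (fun z : plane R * Om => u z.1.1 z.1.2 z.2) /\
  forall t x : R, 0 <= t <= T -> 0 <= x < 1 ->
    {ae P, forall w, (@leb2 R).-integrable (spacetime t)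
      (fun z => (heat_kernel (t - z.1) (x - z.2)
                  * allen_cahn (u z.1 z.2 w))%:E)} /\
    exists2 Z : Om -> R,
      wiener_integral P T W
        (fun z => \1_(spacetime t) z * heat_kernel (t - z.1) (x - z.2)) Z
    & {ae P, forall w, u t x w = drift u t x w + Z w}.

(* Main.v *)
Require Import Defs.
From HB Require Import structures.
From mathcomp Require Import all_boot all_order all_algebra.
From mathcomp Require Import all_classical all_reals all_analysis.
From mathcomp Require Import measurable_realfun ring lra.
Import Order.TTheory GRing.Theory Num.Theory.
Import numFieldNormedType.Exports.
Set Implicit Arguments.
Unset Strict Implicit.
Unset Printing Implicit Defensive.
Local Open Scope classical_set_scope.
Local Open Scope ring_scope.

(** The drift at times t and t + h is the integral of allen_cahn (u s y)
    against p_(t-s)(x-y) and p_(t+h-s)(x-y); since the kernel vanishes at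
    nonpositive times, both integrals may be taken over [0, t + h] x [0, 1[.
    Their difference is bounded by the integral of |allen_cahn (u s y)| against
    K(s, y) = |p_(t+h-s)(x-y) - p_(t-s)(x-y)|.

    Hoelder's inequality for the weight K, followed by Tonelli's theorem, gives
      E|Y(t+h,x) - Y(t,x)|^p <= M^p sup E|allen_cahn (u s y)|^p
    with M the total mass of K ([moment_le]); the supremum is finite because
    moments of u of orders p and 3p are bounded. It remains to see that
    M <= C h^(1/beta).

    For s > t, K is a heat kernel, of mass 1 in y, which contributes h. For
    s < t put r = t - s. The Gaussian exponent increases with time, so that
    (r / (r + h)) p_r <= p_(r+h) pointwise. As both kernels have mass 1, this
    one-sided comparison already bounds the L^1 distance of p_r and p_(r+h) by
    2 (1 - r / (r + h)) = 2 h / (r + h)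
    ([integral_heat_kernel_increment]). Integrating over r in [0, t] yields
    2 h ln ((t + h) / h) ([heat_increment_mass]), and h ln (1 / h) is
    dominated by h^(1/beta) for every beta > 1 ([log_le_power]). *)

(** * Integration against a weight *)

Section weight.
Local Open Scope ereal_scope.
Context d (S : measurableType d) (R : realType).
Variable mu : {measure set S -> \bar R}.

Import HBNNSimple.

(** The integral of a nonnegative function is a supremum over the simple
    functions below it, so the smaller function may fail to be measurable; this
    spares a proof that the drift is a random variable. *)
Lemma ae_ge0_le_integralT (f g : S -> \bar R) :
  (forall x, 0 <= f x) -> (forall x, 0 <= g x) -> measurable_fun [set: S] g ->
  {ae mu, forall x, f x <= g x} ->
  \int[mu]_x f x <= \int[mu]_x g x.
Proof.
move=> f0 g0 mg fg; rewrite (ge0_integralTE mu f0).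
apply: ge_ereal_sup => _ [h hf <-].
rewrite -integralT_nnsfun; apply: ae_ge0_le_integral => //.
- by move=> x _; rewrite lee_fin.
- exact/measurable_EFinP.
- by apply: filterS fg => x fgx _; exact: le_trans (hf x) fgx.
Qed.

(** Hoelder's inequality applied to K^(1/p) F and K^(1/q), where q = p/(p-1). *)
Lemma hoelder_weight (K F : S -> R) (p : R) : (1 < p)%R ->
  measurable_fun [set: S] K -> measurable_fun [set: S] F ->
  (forall x, 0 <= K x)%R -> (forall x, 0 <= F x)%R ->
  (\int[mu]_x (K x * F x)%:E) `^ p <=
    (\int[mu]_x (K x)%:E) `^ (p - 1) * \int[mu]_x (K x * F x `^ p)%:E.
Proof.
move=> p1 mK mF K0 F0.
have p0 : (0 < p)%R by exact: lt_trans p1.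
have pn0 : p != 0%R by rewrite gt_eqF.
pose q := (p / (p - 1))%R.
have pm0 : (0 < p - 1)%R by rewrite subr_gt0.
have q0 : (0 < q)%R by rewrite divr_gt0.
have pq : (p^-1 + q^-1 = 1)%R.
  by rewrite /q; field; rewrite pn0 gt_eqF.
have mA : measurable_fun [set: S] (fun x => K x `^ p^-1 * F x)%R.
  by apply: measurable_funM => //; exact: measurableT_comp (measurable_powR _) mK.
have mB : measurable_fun [set: S] (fun x => K x `^ q^-1)%R.
  exact: measurableT_comp (measurable_powR _) mK.
have := hoelder mu mA mB p0 q0 pq; rewrite unlock /= invr1 poweRe1; last first.
  by apply: integral_ge0 => x _; rewrite lee_fin powR_ge0.
under eq_integral => x _.
  rewrite powRr1// ger0_norm; last first.
    by rewrite !mulr_ge0// ?powR_ge0.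
  rewrite mulrAC -powRD ?pq; last by rewrite oner_eq0.
  rewrite powRr1//.
  over.
under [X in _ <= X `^ _ * _]eq_integral => x _.
  rewrite ger0_norm ?mulr_ge0 ?powR_ge0//.
  rewrite powRM ?powR_ge0// -powRrM mulVf// powRr1//.
  over.
under [X in _ <= _ * X `^ _]eq_integral => x _.
  rewrite ger0_norm ?powR_ge0// -powRrM mulVf ?gt_eqF// powRr1//.
  over.
set I := \int[mu]_x _; set J := \int[mu]_x _; set M := \int[mu]_x _.
have I0 : 0 <= I by apply: integral_ge0 => x _; rewrite lee_fin mulr_ge0.
have J0 : 0 <= J.
  by apply: integral_ge0 => x _; rewrite lee_fin mulr_ge0// powR_ge0.
have M0 : 0 <= M by apply: integral_ge0 => x _; rewrite lee_fin.
move=> IJM.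
have -> : M `^ (p - 1) * J = (J `^ p^-1 * M `^ q^-1) `^ p.
  rewrite poweRM ?poweR_ge0// -!poweRrM mulVf// poweRe1//.
  have -> : (q^-1 * p = p - 1)%R by rewrite /q; field; rewrite pn0 gt_eqF.
  by rewrite muleC.
apply: (gt0_ler_poweR (ltW p0)) IJM; rewrite in_itv /= leey andbT//.
by rewrite mule_ge0 ?poweR_ge0.
Qed.

End weight.

Section moment.
Local Open Scope ereal_scope.
Context d (S : measurableType d) d' (Om : measurableType d') (R : realType).
Variable mu : {sigma_finite_measure set S -> \bar R}.
Variable P : probability Om R.

(** An average of the random variables F(z, .) with weight K of mass at most M
    has its p-th moment bounded by M^p times the largest p-th moment of the F(z, .):
    one factor M^(p-1) comes from Hoelder's inequality for each outcome, the
    last factor M from exchanging the expectation with the weighted integral. *)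
Lemma moment_le (K : S -> R) (F : S * Om -> R) (X : Om -> R) (p M B : R) :
  (1 < p)%R -> (0 <= M)%R -> (0 <= B)%R ->
  measurable_fun [set: S] K -> measurable_fun [set: S * Om] F ->
  (forall z, 0 <= K z)%R -> (forall zw, 0 <= F zw)%R ->
  \int[mu]_z (K z)%:E <= M%:E ->
  (forall z, \int[P]_w (F (z, w) `^ p)%:E <= B%:E) ->
  {ae P, forall w, `|X w|%:E <= \int[mu]_z (K z * F (z, w))%:E} ->
  \int[P]_w (`|X w| `^ p)%:E <= (M `^ p * B)%:E.
Proof.
move=> p1 M0 B0 mK mF K0 F0 KM FB XKF.
have p0 : (0 < p)%R by exact: lt_trans p1.
have pm0 : (0 <= p - 1)%R by rewrite subr_ge0 ltW.
pose H := fun zw : S * Om => (K zw.1 * F zw `^ p)%:E.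
have mH : measurable_fun [set: S * Om] H.
  apply/measurable_EFinP; apply: measurable_funM.
    exact: measurableT_comp mK measurable_fst.
  exact: measurableT_comp (measurable_powR _) mF.
have H0 zw : 0 <= H zw by rewrite lee_fin mulr_ge0// powR_ge0.
pose J w := \int[mu]_z H (z, w).
have mJ : measurable_fun [set: Om] J.
  exact: measurable_fun_fubini_tonelli_G.
have J0 w : 0 <= J w by exact: integral_ge0.
have mKE : measurable_fun [set: S] (EFin \o K) by exact/measurable_EFinP.
have M0E : 0 <= \int[mu]_z (K z)%:E.
  by apply: integral_ge0 => z _; rewrite lee_fin.
apply: (@le_trans _ _ (\int[P]_w ((M `^ (p - 1))%:E * J w))).
  apply: ae_ge0_le_integralT.
  - by move=> w; rewrite lee_fin powR_ge0.
  - by move=> w; rewrite mule_ge0// lee_fin powR_ge0.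
  - exact: measurable_funeM.
  apply: filterS XKF => w XKF.
  have KF0 : 0 <= \int[mu]_z (K z * F (z, w))%:E.
    by apply: integral_ge0 => z _; rewrite lee_fin mulr_ge0.
  rewrite -poweR_EFin; apply: (@le_trans _ _ ((\int[mu]_z (K z * F (z, w))%:E) `^ p)).
    apply: (gt0_ler_poweR (ltW p0)) => //; rewrite in_itv/= leey andbT//.
  apply: le_trans (hoelder_weight mu p1 mK (measurable_fun_pair1 w mF) K0 _) _.
    by [].
  apply: lee_wpmul2r; first exact: J0.
  rewrite -poweR_EFin.
  by apply: (gt0_ler_poweR pm0) => //; rewrite in_itv/= leey andbT// lee_fin.
rewrite ge0_integralZl//; last by rewrite lee_fin powR_ge0.
have -> : \int[P]_w J w = \int[mu]_z \int[P]_w H (z, w).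
  by rewrite (@fubini_tonelli _ _ _ _ _ mu P _ mH H0).
have HB : \int[mu]_z \int[P]_w H (z, w) <= B%:E * M%:E.
  apply: (@le_trans _ _ (\int[mu]_z (B%:E * (K z)%:E))).
    apply: ge0_le_integral => //.
    - by move=> z _; exact: integral_ge0.
    - exact: measurable_fun_fubini_tonelli_F.
    - exact: measurable_funeM.
    move=> z _; rewrite /H/=.
    under eq_integral do rewrite EFinM.
    rewrite ge0_integralZl//.
    - by rewrite muleC lee_wpmul2r// lee_fin.
    - apply/measurable_EFinP; apply: measurableT_comp (measurable_powR _) _.
      exact: measurable_fun_pair2.
    - by move=> w _; rewrite lee_fin powR_ge0.
    - by rewrite lee_fin.
  rewrite ge0_integralZl//.
  - by apply: lee_wpmul2l => //; rewrite lee_fin.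
  - by move=> z _; rewrite lee_fin.
apply: (@le_trans _ _ ((M `^ (p - 1))%:E * (B%:E * M%:E))).
  by apply: lee_wpmul2l => //; rewrite lee_fin powR_ge0.
have [->|Mn0] := eqVneq M 0%R.
  by rewrite mule0 mule0 lee_fin mulr_ge0// powR_ge0.
rewrite -!EFinM lee_fin mulrCA mulrC.
rewrite -{2}(@powRr1 _ M)// -powRD ?subrK//.
by rewrite Mn0 implybT.
Qed.

End moment.

(** * Iterated integrals on rectangles *)

Section rectangle.
Local Open Scope ereal_scope.
Context d1 d2 (S1 : measurableType d1) (S2 : measurableType d2) (R : realType).
Variables (m1 : {sigma_finite_measure set S1 -> \bar R})
  (m2 : {sigma_finite_measure set S2 -> \bar R}).
Variables (A : set S1) (B : set S2).
Hypotheses (mA : measurable A) (mB : measurable B).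

Lemma patchX (f : S1 * S2 -> \bar R) x y :
  (f \_ (A `*` B)) (x, y) = if x \in A then ((fun y => f (x, y)) \_ B) y else 0.
Proof.
rewrite !patchE; case: ifPn; rewrite ?(inE, notin_setE)/=.
  by move=> [Ax Bx]; rewrite !mem_set.
move=> nAB; case: ifPn => //; rewrite inE => Ax; case: ifPn => //.
by rewrite inE => By; exfalso; apply: nAB.
Qed.

Lemma integral_patchX (f : S1 * S2 -> \bar R) x :
  \int[m2]_y (f \_ (A `*` B)) (x, y) =
  if x \in A then \int[m2]_(y in B) f (x, y) else 0.
Proof.
under eq_integral do rewrite patchX.
case: ifPn => xA; first by rewrite -integral_mkcond.
by rewrite integral0.
Qed.

Lemma tonelli_rect (f : S1 * S2 -> \bar R) :
  measurable_fun [set: S1 * S2] f -> (forall z, 0 <= f z) ->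
  \int[m1 \x m2]_(z in A `*` B) f z = \int[m1]_(x in A) \int[m2]_(y in B) f (x, y).
Proof.
move=> mf f0.
have mAB : measurable (A `*` B) by exact: measurableX.
rewrite integral_mkcond fubini_tonelli1//.
- rewrite [RHS]integral_mkcond; apply: eq_integral => x _.
  by rewrite /fubini_F integral_patchX patchE.
- apply/(measurable_restrictT _ mAB) ; exact: measurable_funS mf.
- by move=> z; apply: erestrict_ge0.
Qed.

(** The inner real-valued integral takes a default value where the section is
    not integrable; by Fubini this happens only on a null set of sections. *)
Lemma Rintegral_rect (f : S1 * S2 -> R) :
  (m1 \x m2).-integrable (A `*` B) (EFin \o f) ->
  (\int[m1]_(x in A) \int[m2]_(y in B) f (x, y))%R =
  fine (\int[m1 \x m2]_(z in A `*` B) (f z)%:E).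
Proof.
have mAB : measurable (A `*` B) by exact: measurableX.
move/(integrable_mkcond _ mAB).1 => ig.
have iF := integrable_fubini_F ig.
have FE x := integral_patchX (EFin \o f) x.
rewrite [in RHS]integral_mkcond -(integral12_prod_meas1 ig).
congr fine; rewrite integral_mkcond.
apply: ae_eq_integral => //; last first.
  apply: filterS (integrable_ae measurableT iF) => x /(_ Logic.I) + _.
  rewrite /fubini_F FE patchE; case: ifPn => // xA Ffin.
  by rewrite /Rintegral fineK.
- exact: measurable_int iF.
- apply: (eq_measurable_fun (EFin \o (fine \o fubini_F m2 ((EFin \o f) \_ (A `*` B))))).
    by move=> x _; rewrite /= /fubini_F FE patchE; case: ifPn.
  apply/measurable_EFinP; apply: measurableT_comp => //.
  exact: measurable_int iF.
Qed.

End rectangle.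

Lemma measurable_partial_integral d1 d2 (S1 : measurableType d1)
    (S2 : measurableType d2) (R : realType)
    (m2 : {sigma_finite_measure set S2 -> \bar R}) (B : set S2)
    (f : S1 * S2 -> \bar R) : measurable B ->
  measurable_fun [set: S1 * S2] f -> (forall z, 0 <= f z)%E ->
  measurable_fun [set: S1] (fun x => \int[m2]_(y in B) f (x, y))%E.
Proof.
move=> mB mf f0; have mTB : measurable ([set: S1] `*` B) by exact: measurableX.
have mg : measurable_fun [set: S1 * S2] (f \_ ([set: S1] `*` B)).
  by apply/(measurable_restrictT _ mTB); exact: measurable_funS mf.
have g0 z : (0 <= (f \_ ([set: S1] `*` B)) z)%E by apply: erestrict_ge0.
have := @measurable_fun_fubini_tonelli_F _ _ _ _ _ m2 _ mg g0; apply: eq_measurable_fun.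
by move=> x _; rewrite /fubini_F integral_patchX in_setT.
Qed.

(** The product measure with its sigma-finite structure made explicit: the
    canonical structure attached to a product is the one of products of
    subprobabilities, which Lebesgue measure is not. *)
Definition sigma_finite_product d1 d2 (S1 : measurableType d1)
    (S2 : measurableType d2) (R : realType)
    (m1 : {sigma_finite_measure set S1 -> \bar R})
    (m2 : {sigma_finite_measure set S2 -> \bar R}) :
    {sigma_finite_measure set (S1 * S2)%type -> \bar R} :=
  HB.pack_for {sigma_finite_measure set (S1 * S2)%type -> \bar R} (m1 \x m2)%E
    (Measure_isSigmaFinite.Build _ _ _ (m1 \x m2)%E
      (lebesgue_integral_fubini.product_measure_sigma_finite_subproof m1 m2)).

(** * The periodic heat kernel *)

Definition gauss (R : realType) (t z : R) : R :=
  (Num.sqrt (4 * pi * t))^-1 * expR (- z ^+ 2 / (4 * t)).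

(** The value of the periodized kernel before truncation to a real: integrals
    of this series can be exchanged with the sum without knowing that it
    converges. *)
Definition theta (R : realType) (t z : R) : \bar R :=
  \esum_(k in [set: int]) (gauss t (z - k%:~R))%:E.

(** Enumerating the integers turns the sum over them into a series. *)
Definition nat_int (n : nat) : int := if odd n then Negz n./2 else Posz n./2.

Lemma nat_int_bij : set_bij [set: nat] [set: int] nat_int.
Proof.
rewrite setTT_bijective; exists (fun k : int => match k with
  | Posz m => m.*2 | Negz m => m.*2.+1 end).
  by move=> n; rewrite /nat_int; have := odd_double_half n; case: ifP.
move=> [m|m]; rewrite /nat_int /= odd_double ?doubleK//=.
by rewrite uphalf_double.
Qed.

Section kernel.
Context (R : realType).
Implicit Types (t h x y z : R).
Local Notation lam := (@lebesgue_measure R).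

Lemma gauss_ge0 t z : 0 <= gauss t z.
Proof. by rewrite mulr_ge0 ?expR_ge0// invr_ge0. Qed.

Lemma gauss_le0 t z : t <= 0 -> gauss t z = 0.
Proof.
move=> t0; rewrite /gauss ler0_sqrtr ?invr0 ?mul0r//.
by rewrite pmulr_rle0// mulr_gt0// pi_gt0.
Qed.

(** Up to the factor sqrt (t / (t + h)), which is at least t / (t + h), the
    normalizations agree, and the exponent increases with time. *)
Lemma gauss_scale t h z : 0 < t -> 0 < h ->
  t / (t + h) * gauss t z <= gauss (t + h) z.
Proof.
move=> t0 h0; have th0 : 0 < t + h by rewrite addr_gt0.
rewrite /gauss mulrA; apply: ler_pM; rewrite ?expR_ge0//.
- by rewrite mulr_ge0 ?invr_ge0// divr_ge0// ltW.
- have p0 : (0 : R) < 4 * pi by rewrite mulr_gt0// pi_gt0.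
  set a := Num.sqrt _; set b := Num.sqrt _.
  have a0 : 0 < a by rewrite sqrtr_gt0 mulr_gt0.
  have b0 : 0 < b by rewrite sqrtr_gt0 mulr_gt0.
  have ab : a <= b by rewrite ler_wsqrtr// ler_wpM2l ?(ltW p0)// lerDl ltW.
  have -> : t / (t + h) = a ^+ 2 / b ^+ 2.
    rewrite !sqr_sqrtr ?mulr_ge0 ?pi_ge0 ?(ltW t0) ?(ltW th0)//.
    by rewrite -[RHS]mulf_div divff ?mul1r// gt_eqF.
  have -> : a ^+ 2 / b ^+ 2 / a = (a / b) / b.
    by field; rewrite !gt_eqF.
  by rewrite -[leRHS]mul1r ler_wpM2r ?invr_ge0 ?(ltW b0)// ler_pdivrMr ?mul1r.
- rewrite ler_expR !mulNr lerN2 ler_wpM2l ?sqr_ge0//.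
  by rewrite lef_pV2 ?posrE ?mulr_gt0// ler_pM2l// lerDl ltW.
Qed.

(** The identity 1/x = x (x^2)^(-1) reduces the inverse to a power function of a
    nonnegative number, and also holds at 0, where the inverse is 0. *)
Lemma measurable_funV d (S : measurableType d) (f : S -> R) :
  measurable_fun [set: S] f -> measurable_fun [set: S] (fun s => (f s)^-1).
Proof.
move=> mf.
rewrite (_ : (fun s => _) = (fun s => f s * (f s ^+ 2) `^ (- 1))).
  apply: measurable_funM => //.
  exact: measurableT_comp (measurable_powR _) (measurable_funX _ _).
apply/funext => s; rewrite powR_inv1 ?sqr_ge0//.
have [->|fs0] := eqVneq (f s) 0; first by rewrite invr0 mul0r.
by field.
Qed.

Lemma measurable_gauss d (S : measurableType d) (f g : S -> R) :
  measurable_fun [set: S] f -> measurable_fun [set: S] g ->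
  measurable_fun [set: S] (fun s => gauss (f s) (g s)).
Proof.
move=> mf mg; apply: measurable_funM.
  apply: measurable_funV.
  apply: (measurableT_comp (continuous_measurable_fun (@sqrt_continuous R))).
  exact: measurable_funM.
apply: measurableT_comp => //; apply: measurable_funM.
  by apply: measurableT_comp => //; exact: measurable_funX.
apply: measurable_funV.
exact: measurable_funM.
Qed.

(** This is the density of the normal law with mean x and variance 2t. *)
Lemma integral_gauss t x : 0 < t -> (\int[lam]_z (gauss t (x - z))%:E = 1)%E.
Proof.
move=> t0; have s0 : Num.sqrt (2 * t) != 0.
  by rewrite gt_eqF// sqrtr_gt0 mulr_gt0.
rewrite -(integral_normal_pdf x (Num.sqrt (2 * t))).
apply: eq_integral => z _; congr EFin.
rewrite /normal_pdf (negbTE s0) /normal_peak /normal_fun /gauss.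
rewrite sqr_sqrtr; last by rewrite mulr_ge0// ltW.
by congr (_^-1 * expR _); [congr Num.sqrt; ring|field; rewrite gt_eqF].
Qed.

Lemma theta_series t z :
  theta t z = (\sum_(n <oo) (gauss t (z - (nat_int n)%:~R))%:E)%E.
Proof.
rewrite /theta (reindex_esum _ _ _ _ nat_int_bij) nneseries_esumT// => n.
by rewrite lee_fin gauss_ge0.
Qed.

Lemma theta_ge0 t z : (0 <= theta t z)%E.
Proof. by apply: esum_ge0 => k _; rewrite lee_fin gauss_ge0. Qed.

Lemma measurable_theta d (S : measurableType d) (f g : S -> R) :
  measurable_fun [set: S] f -> measurable_fun [set: S] g ->
  measurable_fun [set: S] (fun s => theta (f s) (g s)).
Proof.
move=> mf mg; under eq_fun do rewrite theta_series.
apply: (@ge0_emeasurable_sum _ _ _ _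
  (fun n s => (gauss (f s) (g s - (nat_int n)%:~R))%:E) xpredT).
  by move=> k s _ _; rewrite lee_fin gauss_ge0.
move=> n _; apply/measurable_EFinP; apply: measurable_gauss => //.
exact: measurable_funB.
Qed.

Lemma measurable_heat_kernel d (S : measurableType d) (f g : S -> R) :
  measurable_fun [set: S] f -> measurable_fun [set: S] g ->
  measurable_fun [set: S] (fun s => heat_kernel (f s) (g s)).
Proof.
move=> mf mg; apply: (measurableT_comp (f := fine)); first exact: fine_measurable.
exact: measurable_theta.
Qed.

Lemma heat_kernel_ge0 t z : 0 <= heat_kernel t z.
Proof. by rewrite fine_ge0// theta_ge0. Qed.

Lemma heat_kernel_le0 t z : t <= 0 -> heat_kernel t z = 0.
Proof.
move=> t0; rewrite /heat_kernel -/(gauss t) esum1// => k _.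
by congr EFin; exact: gauss_le0.
Qed.

Lemma theta_scale t h z : 0 < t -> 0 < h ->
  ((t / (t + h))%:E * theta t z <= theta (t + h) z)%E.
Proof.
move=> t0 h0; rewrite !theta_series -nneseriesZl//; last first.
  by move=> n _; rewrite lee_fin gauss_ge0.
apply: lee_nneseries => n _.
  by rewrite -EFinM lee_fin mulr_ge0 ?gauss_ge0// divr_ge0 ?addr_ge0// ltW.
by rewrite -EFinM lee_fin gauss_scale.
Qed.

Lemma lebesgue_measure_shift (c : R) (A : set R) : measurable A ->
  pushforward lam ((fun y => y + c) : _ -> measurableTypeR R) A = lam A.
Proof.
move=> mA.
have mc : measurable_fun [set: measurableTypeR R]
    ((fun y => y + c) : _ -> measurableTypeR R).
  exact: measurable_funD.
apply/esym/(lebesgue_measure_unique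
    (mu := pushforward lam ((fun y => y + c) : _ -> measurableTypeR R)))
  => //= _ [[a b]] _ <-.
rewrite /pushforward.
have -> : (fun y => y + c) @^-1` `]a, b]%classic = `]a - c, b - c]%classic.
  by apply/seteqP; split => y /=; rewrite !in_itv/= ltrBlDr lerBrDr.
rewrite !lebesgue_measure_itv/= !lte_fin ltrD2r -!EFinD.
by have -> : b - c - (a - c) = b - a by ring.
Qed.

Lemma integral_shift (c : R) (A : set R) (f : R -> \bar R) : measurable A ->
  measurable_fun [set: R] f -> (forall z, 0 <= f z)%E ->
  (\int[lam]_(y in (fun y => (y + c)%R) @^-1` A) f (y + c)%R = \int[lam]_(z in A) f z)%E.
Proof.
move=> mA mf f0.
have mc : measurable_fun [set: measurableTypeR R]
    ((fun y => y + c) : _ -> measurableTypeR R).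
  exact: measurable_funD.
rewrite -(ge0_integral_pushforward mc lam mA)//.
- by apply: eq_measure_integral => B mB _; exact: lebesgue_measure_shift.
- by apply: measurable_funTS; exact: mf.
Qed.

(** Shifting the k-th term by k spreads the sum over [0, 1[ into the integral of
    a single Gaussian over the line, partitioned into the intervals [k, k + 1[. *)
Lemma integral_theta t x : 0 < t ->
  (\int[lam]_(y in `[0%R, 1%R[) theta t (x - y)%R = 1)%E.
Proof.
move=> t0.
pose I n : set R := `[(nat_int n)%:~R, (nat_int n + 1)%:~R[%classic.
have mg c : measurable_fun [set: measurableTypeR R] (fun y => (gauss t (x - y - c))%:E).
  apply/measurable_EFinP/measurable_gauss => //.
  by do 2 apply: measurable_funB => //.
under eq_integral do rewrite theta_series.
rewrite integral_nneseries//; first last.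
- by move=> n y _; rewrite lee_fin gauss_ge0.
- by move=> n; apply: measurable_funTS; exact: mg.
have mg0 : measurable_fun [set: measurableTypeR R] (fun y => (gauss t (x - y))%:E).
  by apply/measurable_EFinP/measurable_gauss => //; exact: measurable_funB.
transitivity (\sum_(n <oo) \int[lam]_(y in I n) (gauss t (x - y))%:E)%E.
  apply: eq_eseriesr => n _.
  rewrite -(integral_shift (nat_int n)%:~R)//; first last.
  - by move=> z; rewrite lee_fin gauss_ge0.
  - exact: measurable_itv.
  have -> : (fun y => y + (nat_int n)%:~R) @^-1` I n = `[0, 1[%classic.
    apply/seteqP; split => y; rewrite /= /I/= !in_itv/= intrD.
      by lra.
    by lra.
  by apply: eq_integral => y _; rewrite opprD addrA.
rewrite -ge0_integral_bigcup//.
- rewrite (_ : \bigcup_n _ = setT) ?integral_gauss//.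
  apply/seteqP; split => // y _.
  have [_ _ /(_ (Num.floor y))[|n _ nE]] := nat_int_bij; first by [].
  by exists n => //; rewrite /I nE/= in_itv/= floor_itv.
- by move=> n; exact: measurable_itv.
- by apply: measurable_funTS; exact: mg0.
- by move=> y _; rewrite lee_fin gauss_ge0.
apply/trivIsetP => m n _ _ mn; apply/seteqP; split => // y; rewrite /I/= !in_itv/=.
move=> [/floor_def ym /floor_def yn]; move: mn.
have [_ inj _] := nat_int_bij.
by rewrite (inj m n) ?inE ?eqxx// -ym -yn.
Qed.

Lemma integral_heat_kernel_le1 t x :
  (\int[lam]_(y in `[0%R, 1%R[) (heat_kernel t (x - y))%:E <= 1)%E.
Proof.
have [t0|t0] := leP t 0.
  rewrite integral0_eq// => y _; first by rewrite heat_kernel_le0.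
rewrite -(integral_theta x t0); apply: ge0_le_integral => //.
- by move=> y _; rewrite lee_fin heat_kernel_ge0.
- apply: measurable_funTS; apply/measurable_EFinP/measurable_heat_kernel => //.
  exact: measurable_funB.
- by apply: measurable_funTS; apply/measurable_theta => //; exact: measurable_funB.
- move=> y _; rewrite /heat_kernel -/(theta t (x - y)).
  have := theta_ge0 t (x - y); by case: (theta t (x - y)).
Qed.

(** If v b <= a with 0 <= v <= 1, then |a - b| <= (a - v b) + (1 - v) b. For
    a = p_(t+h), b = p_t and v = t / (t + h), both of mass 1, integrating gives
    2 (1 - v). The term v b is kept on the left so that only sums of
    nonnegative functions are integrated. *)
Lemma integral_heat_kernel_increment t h x : 0 < t -> 0 < h ->
  (\int[lam]_(y in `[0%R, 1%R[)
     (`|heat_kernel (t + h) (x - y) - heat_kernel t (x - y)|)%:E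
   <= (2 * h / (t + h))%:E)%E.
Proof.
move=> t0 h0; have th0 : 0 < t + h by rewrite addr_gt0.
set v := t / (t + h).
have v0 : 0 <= v by rewrite divr_ge0// ltW.
have v1 : v <= 1 by rewrite ler_pdivrMr// mul1r lerDl ltW.
have mt s : measurable_fun [set: measurableTypeR R] (fun y => theta s (x - y)).
  by apply/measurable_theta => //; exact: measurable_funB.
have mvt c s : measurable_fun [set: measurableTypeR R] (fun y => c%:E * theta s (x - y))%E.
  exact: measurable_funeM.
have mk s : measurable_fun [set: measurableTypeR R] (fun y => heat_kernel s (x - y)).
  by apply/measurable_heat_kernel => //; exact: measurable_funB.
have mD : measurable_fun [set: measurableTypeR R] (fun y =>
    (`|heat_kernel (t + h) (x - y) - heat_kernel t (x - y)|)%:E).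
  apply/measurable_EFinP; apply: measurableT_comp => //.
  exact: measurable_funB.
(* The series converges for almost every y because its integral is 1. *)
have int1 s : 0 < s -> lam.-integrable `[0, 1[ (fun y => theta s (x - y)).
  move=> s0; apply/integrableP; split; first exact: measurable_funTS.
  under eq_integral do rewrite gee0_abs ?theta_ge0//.
  by rewrite integral_theta// ltry.
have fin s : 0 < s -> {ae lam, forall y, `[0, 1[%classic y ->
    theta s (x - y) \is a fin_num}.
  by move=> s0; apply: integrable_ae => //; exact: int1.
have : (\int[lam]_(y in `[0%R, 1%R[)
     ((`|heat_kernel (t + h) (x - y) - heat_kernel t (x - y)|)%:E +
       v%:E * theta t (x - y)) <=
   \int[lam]_(y in `[0%R, 1%R[)
     (theta (t + h) (x - y) + (1 - v)%:E * theta t (x - y)))%E.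
  apply: ae_ge0_le_integral => //.
  - by move=> y _; rewrite adde_ge0 ?mule_ge0 ?theta_ge0// lee_fin.
  - by apply: measurable_funTS; exact: emeasurable_funD.
  - by move=> y _; rewrite adde_ge0 ?mule_ge0 ?theta_ge0// lee_fin subr_ge0.
  - by apply: measurable_funTS; exact: emeasurable_funD.
  have aef : Filter (nbhs (almost_everywhere lam)).
    exact: (ae_filter_ringOfSetsType
      (@lebesgue_measure R : {measure set (measurableTypeR R) -> \bar R})).
  apply: (filterS2 _ _ (fin _ t0) (fin _ th0)) => y tf thf y01.
  have := theta_scale (x - y) t0 h0.
  have := theta_ge0 t (x - y).
  rewrite /heat_kernel -/(theta t (x - y)) -/(theta (t + h) (x - y)) -/v.
  move: (tf y01) (thf y01); case: (theta t _) => // b _; case: (theta _ _) => // a _.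
  rewrite -!EFinM -!EFinD !lee_fin /= => b0 vba.
  have : `|a - b| <= `|a - v * b| + `|(1 - v) * b|.
    apply: le_trans (ler_normB _ _); rewrite le_eqVlt; apply/orP; left.
    by apply/eqP; congr `|_|; ring.
  rewrite [`|a - v * b|]ger0_norm ?subr_ge0// [`|(1 - v) * b|]ger0_norm; last first.
    by rewrite mulr_ge0// subr_ge0.
  lra.
rewrite !ge0_integralD//; try exact: measurable_funTS;
  try by move=> y _; rewrite ?mule_ge0 ?theta_ge0// lee_fin subr_ge0.
rewrite !ge0_integralZl//; try exact: measurable_funTS;
  try by move=> *; rewrite ?theta_ge0// lee_fin subr_ge0.
rewrite !integral_theta// !mule1 -leeBrDr// -!EFinD => /le_trans; apply.
rewrite lee_fin /v le_eqVlt; apply/orP; left; apply/eqP; field.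
by rewrite gt_eqF.
Qed.

End kernel.

(** * Mass of the time increment of the kernel *)

Section increment.
Context (R : realType).
Implicit Types (t h x : R).
Local Notation lam := (@lebesgue_measure R).

Lemma integral_inverse_shift (b t c : R) : 0 < t -> t < b ->
  (\int[lam]_(s in `[0%R, t]) (c / (b - s))%:E = (c * ln (b / (b - t)))%:E)%E.
Proof.
move=> t0 tb.
have pos s : s <= t -> 0 < b - s by move=> st; rewrite subr_gt0; exact: le_lt_trans tb.
pose F s := - c * ln (b - s).
have dF s : s <= t -> is_derive s 1 F (c / (b - s)).
  move=> st.
  have dsub : is_derive s 1 (fun s => b - s) (- 1).
    by rewrite -[- 1]add0r; apply: is_deriveB.
  have dln := is_derive1_ln (pos _ st).
  have dcomp := @is_derive1_comp _ (@ln R) (fun s => b - s) s _ _ dln dsub.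
  have -> : c / (b - s) = - c *: ((b - s)^-1 * -1).
    by rewrite /GRing.scale/= mulrN1 mulrNN.
  exact: is_deriveZ.
have cF s : s <= t -> {for s, continuous F}.
  move=> st; apply/differentiable_continuous/derivable1_diffP.
  by have [] := dF _ st.
rewrite (@continuous_FTC2 _ _ F)//.
- rewrite /F subr0 -EFinD ln_div ?posrE ?pos//; last by rewrite (lt_trans t0).
  by congr EFin; ring.
- apply: continuous_in_subspaceT => s; rewrite inE/= in_itv/= => /andP[_ st].
  apply: cvgM; first exact: cvg_cst.
  apply: cvgV; first by rewrite gt_eqF// pos.
  by apply: cvgB; [exact: cvg_cst|exact: cvg_id].
- split.
  + by move=> s; rewrite in_itv/= => /andP[_ /ltW st]; have [] := dF _ st.
  + by apply: cvg_at_right_filter; apply: cF; exact: ltW.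
  + by apply: cvg_at_left_filter; exact: cF.
- move=> s; rewrite in_itv/= => /andP[_ /ltW st].
  by rewrite derive1E; have [] := dF _ st.
Qed.

Definition heat_increment t h x (z : plane R) : R :=
  `|heat_kernel (t + h - z.1) (x - z.2) - heat_kernel (t - z.1) (x - z.2)|.

Lemma measurable_heat_shift t x :
  measurable_fun [set: plane R] (fun z => heat_kernel (t - z.1) (x - z.2)).
Proof.
by apply: measurable_heat_kernel; apply: measurable_funB.
Qed.

Lemma measurable_heat_increment t h x :
  measurable_fun [set: plane R] (heat_increment t h x).
Proof.
apply: measurableT_comp => //.
by apply: measurable_funB; exact: measurable_heat_shift.
Qed.

(** The slice at time s has mass at most 2 h / (t - s + h) when s <= t and at
    most 1 when s >= t, where the kernel at time t - s is zero. *)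
Lemma heat_increment_mass t h x : 0 <= t -> 0 < h ->
  (\int[@leb2 R]_(z in spacetime (t + h)) (heat_increment t h x z)%:E
    <= (2 * h * ln ((t + h) / h) + h)%:E)%E.
Proof.
move=> t0 h0; have th0 : 0 < t + h by rewrite ltr_wpDl.
pose f (z : plane R) : \bar R := (heat_increment t h x z)%:E.
have mf : measurable_fun [set: plane R] f.
  apply/measurable_EFinP; exact: measurable_heat_increment.
have f0 z : (0 <= f z)%E by rewrite lee_fin normr_ge0.
rewrite /leb2 /spacetime (@tonelli_rect _ _ _ _ _ lebesgue_measure lebesgue_measure _ _ _ _ f)//.
pose G s := (\int[lam]_(y in `[0%R, 1%R[) f (s, y))%E.
have G0 s : (0 <= G s)%E by apply: integral_ge0.
have mG : measurable_fun [set: measurableTypeR R] G.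
  by apply: measurable_partial_integral => //; exact: measurable_itv.
have Gh s : t <= s -> (G s <= 1)%E.
  move=> ts; apply: le_trans (integral_heat_kernel_le1 (t + h - s) x).
  rewrite le_eqVlt; apply/orP; left; apply/eqP.
  apply: eq_integral => y _; rewrite /f /heat_increment/=.
  by rewrite (@heat_kernel_le0 _ (t - s)) ?subr_le0// subr0 ger0_norm// heat_kernel_ge0.
have Gt s : s <= t -> (G s <= (2 * h / (t + h - s))%:E)%E.
  rewrite le_eqVlt => /predU1P[->|st].
    apply: le_trans (Gh _ (lexx _)) _; rewrite addrAC subrr add0r mulfK ?gt_eqF//.
    by rewrite lee_fin ler1n.
  have ts0 : 0 < t - s by rewrite subr_gt0.
  have := integral_heat_kernel_increment x ts0 h0.
  by rewrite addrAC.
have -> : `[0, t + h]%classic = `[0, t]%classic `|` `]t, t + h]%classic :> set R.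
  by rewrite -itv_bndbnd_setU// bnd_simp// lerDl ltW.
have mGS (D : set (measurableTypeR R)) : measurable_fun D G by exact: measurable_funTS.
rewrite ge0_integral_setU//=; first last.
- rewrite disj_set2E; apply/eqP/seteqP; split => // s [] /=; rewrite !in_itv/=.
  by move=> /andP[_ st] /andP[]; rewrite ltNge st.
- by move=> s _; exact: G0.
rewrite EFinD; apply: leeD.
- (* The fundamental theorem of calculus is stated for nondegenerate intervals. *)
  have [->|tn0] := eqVneq t 0.
    rewrite set_itv1 integral_set1 add0r divff ?gt_eqF// ln1 mulr0.
    done.
  have tpos : 0 < t by rewrite lt_neqAle eq_sym tn0.
  have -> : (t + h) / h = (t + h) / (t + h - t) by rewrite addrAC subrr add0r.
  rewrite -integral_inverse_shift// ?ltrDl//.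
  apply: ge0_le_integral => //.
  + by move=> s _; exact: G0.
  + apply: measurable_funTS; apply/measurable_EFinP; apply: measurable_funM => //.
    by apply: measurable_funV; exact: measurable_funB.
  + by move=> s; rewrite /= in_itv/= => /andP[_ st]; exact: Gt.
- apply: (@le_trans _ _ (\int[lam]_(s in `]t, (t + h)%R]) cst 1 s)%E).
    apply: ge0_le_integral => //; first by move=> s _; exact: G0.
    by move=> s; rewrite /= in_itv/= => /andP[/ltW ts _]; exact: Gh.
  rewrite integral_cst// mul1e/= lebesgue_measure_itv/= lte_fin ltrDl h0.
  by rewrite -EFinD addrAC subrr add0r.
Qed.

(** With e = 1 - 1/beta one has h = h^e h^(1/beta), and h^e ln (b/h) is at most
    h^e (b/h)^e / e = b^e / e. *)
Lemma log_le_power (T beta h b : R) : 1 < beta -> 0 < h -> h <= b <= T ->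
  2 * h * ln (b / h) + h <=
    T `^ (1 - beta^-1) * (2 / (1 - beta^-1) + 1) * h `^ beta^-1.
Proof.
move=> b1 h0 /andP[hb bT]; have b0 : 0 < b by exact: lt_le_trans hb.
have T0 : 0 < T by exact: lt_le_trans bT.
have hT : h <= T by exact: le_trans bT.
set e := 1 - beta^-1.
have e0 : 0 < e by rewrite subr_gt0 invf_lt1// (lt_trans _ b1).
have hE : h = h `^ e * h `^ beta^-1.
  rewrite -powRD ?subrK ?powRr1 ?(ltW h0)//.
  by rewrite (gt_eqF h0) implybT.
have he0 : 0 < h `^ e by rewrite powR_gt0.
have hbeta0 : 0 < h `^ beta^-1 by rewrite powR_gt0.
have heT : h `^ e <= T `^ e.
  by apply: ge0_ler_powR => //; rewrite ?nnegrE ltW.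
have lnle : h `^ e * ln (b / h) <= T `^ e / e.
  have y0 : 0 < b / h by rewrite divr_gt0.
  rewrite ler_pdivlMr// -mulrA [ln _ * _]mulrC -ln_powR.
  apply: (@le_trans _ _ (h `^ e * (b / h) `^ e)).
    by rewrite ler_pM2l// ltW// ln_sublinear// powR_gt0.
  rewrite -powRM ?(ltW h0) ?(ltW y0)// mulrCA divff ?gt_eqF// mulr1.
  by apply: ge0_ler_powR => //; rewrite ?nnegrE ltW.
rewrite {1 3}hE.
have -> : 2 * (h `^ e * h `^ beta^-1) * ln (b / h) + h `^ e * h `^ beta^-1 =
  (2 * (h `^ e * ln (b / h)) + h `^ e) * h `^ beta^-1 by ring.
rewrite ler_pM2r// mulrDr mulr1 lerD//.
by rewrite [leRHS]mulrCA ler_pM2l.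
Qed.

End increment.

(** * Increments of the drift *)

Section drift.
Context (R : realType).

Lemma measurable_spacetime (T : R) : measurable (spacetime T).
Proof. by apply: measurableX; exact: measurable_itv. Qed.

Lemma spacetimeS (s t : R) : s <= t -> spacetime s `<=` spacetime t.
Proof.
move=> st z [/= z1 z2]; split => //; move: z1; rewrite /= !in_itv/=.
by move=> /andP[-> /le_trans]; exact.
Qed.

Lemma powR_add_le (a b p : R) : 0 <= p -> 0 <= a -> 0 <= b ->
  (a + b) `^ p <= 2 `^ p * (a `^ p + b `^ p).
Proof.
move=> p0; wlog ab : a b / a <= b.
  move=> wl a0 b0; have [/wl|/ltW /wl] := leP a b; first exact.
  by rewrite addrC [X in _ <= _ * X]addrC; exact.
move=> a0 b0; apply: (@le_trans _ _ ((2 * b) `^ p)).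
  by apply: ge0_ler_powR; rewrite ?nnegrE ?addr_ge0 ?mulr_ge0//; lra.
by rewrite powRM// ler_wpM2l ?powR_ge0// lerDr powR_ge0.
Qed.

Lemma allen_cahn_powR_le (p v : R) : 0 <= p ->
  `|allen_cahn v| `^ p <= 2 `^ p * (`|v| `^ p + `|v| `^ (3 * p)).
Proof.
move=> p0; apply: (@le_trans _ _ ((`|v| + `|v| ^+ 3) `^ p)).
  apply: ge0_ler_powR; rewrite ?nnegrE ?addr_ge0 ?exprn_ge0//.
  by rewrite /allen_cahn -normrX; exact: ler_normB.
by apply: le_trans (powR_add_le _ _ _) _; rewrite ?exprn_ge0// powRrM powR_mulrn.
Qed.

(** The kernel at time t - s vanishes for s >= t, so the drift at time t is also
    an integral over [0, t + h] x [0, 1[. *)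
Lemma drift_increment_le (Om : Type) (u : R -> R -> Om -> R) (t h x : R) (w : Om) :
  0 <= h ->
  (@leb2 R).-integrable (spacetime t)
    (fun z => (heat_kernel (t - z.1) (x - z.2) * allen_cahn (u z.1 z.2 w))%:E) ->
  (@leb2 R).-integrable (spacetime (t + h))
    (fun z => (heat_kernel (t + h - z.1) (x - z.2)
                * allen_cahn (u z.1 z.2 w))%:E) ->
  (`|drift u (t + h) x w - drift u t x w|%:E <=
    \int[@leb2 R]_(z in spacetime (t + h))
      (heat_increment t h x z * `|allen_cahn (u z.1 z.2 w)|)%:E)%E.
Proof.
move=> h0; pose f s (z : plane R) :=
  heat_kernel (s - z.1) (x - z.2) * allen_cahn (u z.1 z.2 w).
rewrite -/(EFin \o f t) -/(EFin \o f (t + h)) /leb2 => int_t int_th.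
have mD s := measurable_spacetime s.
have patchE_t : (EFin \o f t) \_ (spacetime t) = (EFin \o f t) \_ (spacetime (t + h)).
  apply/funext => z; rewrite !patchE; case: ifPn => [|zt].
    by rewrite inE => zt; rewrite mem_set//; apply: spacetimeS zt; rewrite lerDl.
  case: ifPn => //; rewrite inE => -[/= z1 z2].
  rewrite /f heat_kernel_le0 ?mul0r// subr_le0.
  move: zt; rewrite notin_setE => zt; rewrite leNgt; apply/negP => z1t.
  by apply: zt; split => //; move: z1; rewrite /= !in_itv/= => /andP[-> _]; exact: ltW.
have int_t' : (@leb2 R).-integrable (spacetime (t + h)) (EFin \o f t).
  apply: (integrable_mkcond _ (mD _)).2; rewrite -patchE_t.
  exact: (integrable_mkcond _ (mD _)).1.
have driftE s : (@leb2 R).-integrable (spacetime s) (EFin \o f s) ->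
    drift u s x w = \int[@leb2 R]_(z in spacetime s) f s z.
  move=> int_s.
  exact: (@Rintegral_rect _ _ _ _ _ lebesgue_measure lebesgue_measure _ _ _ _ (f s) int_s).
rewrite !driftE//.
have -> : \int[@leb2 R]_(z in spacetime t) f t z =
    \int[@leb2 R]_(z in spacetime (t + h)) f t z.
  by congr fine; rewrite integral_mkcond patchE_t -integral_mkcond.
rewrite -RintegralB//.
have int_B : (@leb2 R).-integrable (spacetime (t + h))
    (EFin \o (fun z => f (t + h) z - f t z)).
  by have := integrableB (mD (t + h)) int_th int_t'; apply: eq_integrable.
rewrite EFin_normr_Rintegral//.
apply: le_trans (le_abse_integral _ (mD _) (measurable_int _ int_B)) _.
rewrite le_eqVlt; apply/orP; left; apply/eqP; apply: eq_integral => z _.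
by rewrite /= -normrM; congr (`|_|%:E); rewrite /f; ring.
Qed.

End drift.

Theorem proposition3p4 (R : realType) (T : R) (T_gt0 : 0 < T)
  (d : measure_display) (Om : measurableType d) (P : probability Om R)
  (W : set (plane R) -> Om -> R) (hW : white_noise P T W)
  (u : R -> R -> Om -> R) (hu : mild_solution P T W u)
  (hmom : forall q : R, 2 <= q ->
    (ereal_sup [set 'E_P[(fun w => `|u z.1 z.2 w| `^ q)%R] | z in spacetime T]
       < +oo)%E)
  (p beta : R) (hp : 2 <= p) (hbeta : 4 / 3 < beta < 2) :
  exists2 C : R, 0 < C &
    forall t x h : R, 0 <= t <= T -> 0 <= x < 1 -> 0 < h -> t + h <= T ->
      ('E_P[(fun w => `|drift u (t + h) x w - drift u t x w| `^ p)%R]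
        <= (C * h `^ (p / beta))%:E)%E.
Proof.
have mT := measurable_spacetime T.
have mTO : measurable (spacetime T `*` [set: Om]) by exact: measurableX.
have p0 : 0 <= p by lra.
have [mu husol] := hu.
pose S q := ereal_sup [set 'E_P[(fun w => `|u z.1 z.2 w| `^ q)%R] | z in spacetime T]%E.
have S_ub q z : spacetime T z -> (\int[P]_w (`|u z.1 z.2 w| `^ q)%:E <= S q)%E.
  by move=> Tz; apply: ereal_sup_ubound; exists z => //; rewrite unlock.
have S_ge0 q : (0 <= S q)%E.
  apply: le_trans (S_ub q (0, 0) _).
    by apply: integral_ge0 => w _; rewrite lee_fin powR_ge0.
  by split; rewrite /= in_itv/= lexx ?ltr01//= ltW.
have S_fin q : 2 <= q -> S q = (fine (S q))%:E.
  by move=> q2; rewrite fineK// ge0_fin_numE//; exact: hmom.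
pose B := 2 `^ p * (fine (S p) + fine (S (3 * p))).
have B0 : 0 <= B by rewrite mulr_ge0 ?powR_ge0// addr_ge0// fine_ge0.
pose F : plane R * Om -> R :=
  (fun zw => `|allen_cahn (u zw.1.1 zw.1.2 zw.2)|) \_ (spacetime T `*` [set: Om]).
have mF : measurable_fun [set: plane R * Om] F.
  apply/(measurable_restrictT _ mTO); apply: measurableT_comp => //.
  by apply: measurable_funB => //; exact: measurable_funX.
have F0 zw : 0 <= F zw by rewrite /F patchE; case: ifP.
have FE z w : spacetime T z -> F (z, w) = `|allen_cahn (u z.1 z.2 w)|.
  by move=> Tz; rewrite /F patchE mem_set.
have mus z : spacetime T z -> measurable_fun [set: Om] (u z.1 z.2).
  move=> Tz; pose v : plane R * Om -> R :=
    (fun zw => u zw.1.1 zw.1.2 zw.2) \_ (spacetime T `*` [set: Om]).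
  have mv : measurable_fun [set: plane R * Om] v by apply/(measurable_restrictT _ mTO).
  have -> : u z.1 z.2 = (fun w => v (z, w)).
    by apply/funext => w; rewrite /v patchE mem_set.
  exact: measurable_fun_pair2.
have FB z : (\int[P]_w (F (z, w) `^ p)%:E <= B%:E)%E.
  have [Tz|nTz] := pselect (spacetime T z); last first.
    rewrite integral0_eq ?lee_fin// => w _.
    rewrite /F patchE memNset; last by move=> [].
    by rewrite powR0// gt_eqF//; lra.
  have mup q : measurable_fun [set: Om] (fun w => (`|u z.1 z.2 w| `^ q)%:E).
    apply/measurable_EFinP; apply: measurableT_comp (measurable_powR _) _.
    by apply: measurableT_comp => //; exact: mus.
  apply: (@le_trans _ _ (\int[P]_w ((2 `^ p)%:E *
      ((`|u z.1 z.2 w| `^ p)%:E + (`|u z.1 z.2 w| `^ (3 * p))%:E)))%E).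
    apply: ge0_le_integral => //.
    - by move=> w _; rewrite lee_fin powR_ge0.
    - apply/measurable_EFinP; apply: measurableT_comp (measurable_powR _) _.
      exact: measurable_fun_pair2.
    - by apply: measurable_funeM; exact: emeasurable_funD.
    - by move=> w _; rewrite FE// -EFinD -EFinM lee_fin allen_cahn_powR_le.
  rewrite ge0_integralZl//; first last.
  - by move=> w _; rewrite adde_ge0// lee_fin powR_ge0.
  - exact: emeasurable_funD.
  rewrite ge0_integralD//; try by move=> w _; rewrite lee_fin powR_ge0.
  rewrite /B EFinM EFinD -!S_fin ?lee_wpmul2l ?lee_fin ?powR_ge0//; last by lra.
  by apply: leeD; exact: S_ub.
(* The constant of the mass bound, uniform in t, x and h. *)
have b1 : 1 < beta by lra.
pose C0 := T `^ (1 - beta^-1) * (2 / (1 - beta^-1) + 1).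
have C00 : 0 <= C0.
  have : 0 < 1 - beta^-1 by rewrite subr_gt0 invf_lt1//; lra.
  by move=> e0; rewrite mulr_ge0 ?powR_ge0// addr_ge0// divr_ge0// ltW.
(* The summand 1 makes the constant positive even if the moments vanish. *)
exists (C0 `^ p * B + 1); first by rewrite ltr_wpDl// mulr_ge0// powR_ge0.
move=> t x h /andP[t0 tT] x01 h0 thT.
pose M := C0 * h `^ beta^-1.
have M0 : 0 <= M by rewrite mulr_ge0// powR_ge0.
pose K : plane R -> R := heat_increment t h x \_ (spacetime (t + h)).
have mth := measurable_spacetime (t + h).
have mK : measurable_fun [set: plane R] K.
  apply/(measurable_restrictT _ mth); apply: measurable_funTS.
  exact: measurable_heat_increment.
have K0 z : 0 <= K z by rewrite /K patchE; case: ifP => // _; exact: normr_ge0.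
have KM : (\int[@leb2 R]_z (K z)%:E <= M%:E)%E.
  have -> : (\int[@leb2 R]_z (K z)%:E =
      \int[@leb2 R]_(z in spacetime (t + h)) (heat_increment t h x z)%:E)%E.
    rewrite [RHS]integral_mkcond; apply: eq_integral => z _.
    by rewrite /K !patchE; case: ifP.
  apply: le_trans (heat_increment_mass x t0 h0) _; rewrite lee_fin.
  by apply: log_le_power => //; rewrite lerDr t0.
have KF : {ae P, forall w, (`|drift u (t + h) x w - drift u t x w|%:E <=
    \int[@leb2 R]_z (K z * F (z, w))%:E)%E}.
  have t01 : 0 <= t <= T by rewrite t0.
  have th01 : 0 <= t + h <= T by rewrite thT addr_ge0// ltW.
  have [int_t _] := husol _ _ t01 x01; have [int_th _] := husol _ _ th01 x01.
  apply: filterS2 int_t int_th => w int_t int_th.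
  apply: le_trans (drift_increment_le (ltW h0) int_t int_th) _.
  rewrite integral_mkcond le_eqVlt; apply/orP; left; apply/eqP.
  apply: eq_integral => z _; rewrite /K !patchE; case: ifPn; last by rewrite mul0r.
  by rewrite inE => zth; rewrite FE//; exact: spacetimeS zth.
have p1 : 1 < p by lra.
have := @moment_le _ _ _ _ _
  (sigma_finite_product (@lebesgue_measure R) (@lebesgue_measure R))
  P K F _ p M B p1 M0 B0 mK mF K0 F0 KM FB KF.
rewrite unlock => /le_trans; apply.
rewrite lee_fin /M powRM ?powR_ge0// -powRrM [beta^-1 * p]mulrC.
rewrite mulrAC ler_wpM2r ?powR_ge0//.
by rewrite lerDl.
Qed.
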